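(* Let $d$ be a positive integer, $\alpha, L>0$, $0<\varepsilon_0\le 1$, and let $p,q\ge 1$ be real numbers. There exists a constant $c>0$, depending only on $d,\alpha,L,\varepsilon_0,p,q$, such that the following holds. Let $K\subset\mathbb{R}^d$ be a convex body with $K\subseteq B_d(0,1)$, and let $\mu$ be a probability measure on $\mathbb{R}^d$ whose support is contained in $K$, such that $$\mu\left(C_K(u,\varepsilon)\right)\ge L\varepsilon^\alpha\quad\text{for all } u\in\mathbb{S}^{d-1} \text{ and all } \varepsilon\in[0,\varepsilon_0].$$ For every integer $n\ge 1$, let $\hat K_n$ be the convex hull of $n$ i.i.d. random points $X_1,\dots,X_n$ with distribution $\mu$. Then for every $n\ge 1$, $$\mathbb{E}\left[\|h_K-h_{\hat K_n}\|_p^q\right]\le c\,n^{-q/\alpha}\qquad\text{and}\qquad \mathbb{E}\left[\|w_K-w_{\hat K_n}\|_p^q\right]\le c\,n^{-q/\alpha}.$$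
   Context: A convex body in $\mathbb{R}^d$ is a compact convex set with nonempty interior. $B_d(a,r)$ is the closed Euclidean ball with center $a$ and radius $r$; $\mathbb{S}^{d-1}$ is the Euclidean unit sphere. The support function of a compact set $A$ is $h_A(u)=\max\{\langle u,x\rangle:x\in A\}$, and the width function of a compact convex set $A$ is $w_A(u)=h_A(u)+h_A(-u)$, $u\in\mathbb{S}^{d-1}$. The cap is $C_K(u,\varepsilon)=\{x\in K:\langle u,x\rangle\ge h_K(u)-\varepsilon\}$. For measurable $f:\mathbb{S}^{d-1}\to\mathbb{R}$ and real $p\ge 1$, $\|f\|_p=\left(\int_{\mathbb{S}^{d-1}}|f(u)|^p\,d\sigma(u)\right)^{1/p}$, where $\sigma$ is the uniform probability measure on $\mathbb{S}^{d-1}$. *)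

(* Defs.v *)
From mathcomp Require Import all_boot all_order all_algebra.
From mathcomp Require Import interval_inference.
From mathcomp Require Import all_classical all_reals all_analysis.

Set Implicit Arguments.
Unset Strict Implicit.
Unset Printing Implicit Defensive.

Import Order.TTheory GRing.Theory Num.Theory.
Import numFieldNormedType.Exports.

Local Open Scope classical_set_scope.
Local Open Scope ring_scope.

(* The library norm of 'rV[R]_d is the sup norm: it is used only through its
   topology, which is the Euclidean one. *)
Definition dotp (R : realType) (d : nat) (u v : 'rV[R]_d) : R :=
  \sum_(i < d) u ord0 i * v ord0 i.

Definition enorm (R : realType) (d : nat) (u : 'rV[R]_d) : R :=
  Num.sqrt (dotp u u).

Definition eball (R : realType) (d : nat) (a : 'rV[R]_d) (r : R) :
    set 'rV[R]_d :=
  [set x | enorm (x - a) <= r].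

Definition usphere (R : realType) (d : nat) : set 'rV[R]_d :=
  [set u | enorm u = 1].

Definition convex_body (R : realType) (d : nat) (K : set 'rV[R]_d) : Prop :=
  [/\ compact K, convex_set (K : set (convex_lmodType 'rV[R]_d)) &
      interior K !=set0].

Definition conv_hull (R : realType) (d : nat) (A : set 'rV[R]_d) :
    set 'rV[R]_d :=
  smallest (fun C : set 'rV[R]_d =>
              convex_set (C : set (convex_lmodType 'rV[R]_d))) A.

(* On nonempty compact sets the supremum is a maximum. *)
Definition supp_fun (R : realType) (d : nat) (A : set 'rV[R]_d)
    (u : 'rV[R]_d) : R :=
  sup [set dotp u x | x in A].

Definition width_fun (R : realType) (d : nat) (A : set 'rV[R]_d)
    (u : 'rV[R]_d) : R :=
  supp_fun A u + supp_fun A (- u).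

Definition cap (R : realType) (d : nat) (K : set 'rV[R]_d) (u : 'rV[R]_d)
    (eps : R) : set 'rV[R]_d :=
  [set x | K x /\ supp_fun K u - eps <= dotp u x].

(* R^d as a measurable space, with its Borel sigma-algebra. *)
Definition rVborel (R : realType) (d : nat) :=
  g_sigma_algebraType (@open 'rV[R]_d).

Definition msupport (R : realType) (d : nat)
    (mu : {measure set (rVborel R d) -> \bar R}) : set 'rV[R]_d :=
  [set x | forall U : set 'rV[R]_d, open U -> U x -> (0 < mu U)%E].

(* The uniform probability measure on the unit sphere, as a Borel measure on
   the ambient space: it is the only Borel probability measure carried by the
   sphere and invariant under the whole orthogonal group (for d = 1, the group
   {1, -1}). *)
Definition sphere_uniform (R : realType) (d : nat)
    (sigma : probability (rVborel R d) R) : Prop :=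
  sigma (@usphere R d) = 1%E /\
  forall Q : 'M[R]_d, Q *m Q^T = 1%:M ->
  forall A : set (rVborel R d), measurable A ->
    sigma [set x : 'rV[R]_d | A (x *m Q)] = sigma A.

Definition mutually_independent (R : realType) (dT dS : measure_display)
    (T : measurableType dT) (S : measurableType dS) (P : probability T R)
    (n : nat) (X : 'I_n -> {RV P >-> S}) : Prop :=
  forall (J : {set 'I_n}) (A : 'I_n -> set S), (forall i, measurable (A i)) ->
    P (\bigcap_(i in [set` J]) (X i @^-1` A i)) =
    (\prod_(i in J) P (X i @^-1` A i))%E.

Definition iid (R : realType) (dT dS : measure_display)
    (T : measurableType dT) (S : measurableType dS) (P : probability T R)
    (mu : probability S R) (n : nat) (X : 'I_n -> {RV P >-> S}) : Prop :=
  mutually_independent X /\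
  forall (i : 'I_n) (A : set S), measurable A -> distribution P (X i) A = mu A.

Definition hat_K (R : realType) (d : nat) (dT : measure_display)
    (T : measurableType dT) (P : probability T R) (n : nat)
    (X : 'I_n -> {RV P >-> rVborel R d}) (w : T) : set 'rV[R]_d :=
  conv_hull (range (fun i : 'I_n => (X i w : 'rV[R]_d))).

(* The expectation of (the Lp(sigma)-norm of (f w)) ^ q, for a random function
   (f w) on R^d; sigma is meant to be carried by the sphere, so that the norm
   depends only on the restriction of (f w) to the sphere. *)
Definition E_Lnorm_pow (R : realType) (d : nat) (dT : measure_display)
    (T : measurableType dT) (P : probability T R)
    (sigma : probability (rVborel R d) R) (p q : R)
    (f : T -> 'rV[R]_d -> R) : \bar R :=
  (\int[P]_w ((Lnorm sigma p%:E (fun u : rVborel R d => (f w u)%:E)) `^ q))%E.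

(* Main.v *)
Require Import Defs.
From mathcomp Require Import all_boot all_order all_algebra.
From mathcomp Require Import interval_inference.
From mathcomp Require Import all_classical all_reals all_analysis.
From mathcomp Require Import measurable_realfun ring lra.

Set Implicit Arguments.
Unset Strict Implicit.
Unset Printing Implicit Defensive.

Import Order.TTheory GRing.Theory Num.Theory.
Import numFieldNormedType.Exports.

Local Open Scope classical_set_scope.
Local Open Scope ring_scope.

(** Write D(u) = h_K(u) - h_{hat K_n}(u) for the deficit of the random hull in
direction u.  If D(u) > t then no sample point lies in the cap C_K(u, t), and
by independence and the cap hypothesis this has probability at most
(1 - L t^alpha)^n <= exp (- n L t^alpha) when t <= eps0.  Almost surely
0 <= D(u) <= 2, so shrinking t by the factor eps0 / 2 turns this into a bound
P(D(u) > t) <= exp (- c n t^alpha) for all t > 0, with c independent of u, K,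
mu and n.  At the scale s = n^(-1/alpha) the tail is exp (- c (t/s)^alpha), and
hence E D(u)^r <= C s^r for each fixed u on the sphere and each r
([deficit_moment_le]).

The passage from a fixed direction to the norm needs no uniformity in u.  With
r = max(p, q), monotonicity of means on the probability spaces of u and of w
gives E ||D||_p^q <= (E ||D||_r^r)^(q/r), and E ||D||_r^r is the sphere average
of E D(u)^r by Tonelli ([expectation_Lnorm_le]).  The two displays yield
C^(q/r) s^q, which is the claimed rate.  For the width, the deficit in
direction u is D(u) + D(-u), so its r-th moment is at most
2^r (E D(u)^r + E D(-u)^r).

Two facts about the data have to be supplied.  The measure mu is carried by K,
because the complement of its support is a countable union of null rational
boxes ([negligible_setC_msupport]).  The deficit is jointly measurable in
(w, u), because h_K is lower semicontinuous and the support function of the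
hull of finitely many points is the maximum of finitely many inner products. *)

(** * Monotonicity of power means *)

Section power_means.
Context (R : realType).

(** Concavity of [x `^ theta], by comparison with the tangent at 1; obtained as
    Young's inequality for the product of [x `^ theta] and 1. *)
Lemma powR_le_tangent (x theta : R) : 0 <= x -> 0 < theta <= 1 ->
  x `^ theta <= theta * x + (1 - theta).
Proof.
move=> x_ge0 /andP[theta_gt0]; rewrite le_eqVlt => /predU1P[->|theta_lt1].
  by rewrite powRr1// subrr addr0 mul1r.
have theta'_gt0 : 0 < 1 - theta by rewrite subr_gt0.
have := @conjugate_powR R (x `^ theta) 1 theta^-1 (1 - theta)^-1
  (powR_ge0 _ _) ler01.
rewrite !invr_gt0 !invrK => /(_ theta_gt0 theta'_gt0).
rewrite -powRrM divff ?gt_eqF// powRr1// powR1 mulr1 mul1r mulrC; apply.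
by rewrite addrC subrK.
Qed.

(** Jensen's inequality for the concave power.  Integrating the tangent bound,
    rescaled to the point M, gives M^theta for any real M > 0 that bounds the
    integral of Y.  Keeping M as a parameter covers a null integral, where the
    mean itself cannot serve as the point of tangency: let M tend to 0. *)
Lemma integral_poweR_le d (T : measurableType d) (P : probability T R)
    (Y : T -> \bar R) (theta : R) :
  measurable_fun setT Y -> (forall w, 0 <= Y w)%E -> 0 < theta <= 1 ->
  (\int[P]_w (Y w `^ theta) <= (\int[P]_w Y w) `^ theta)%E.
Proof.
move=> mY Y_ge0 /andP[theta_gt0 theta_le1].
have mYt : measurable_fun setT (fun w => Y w `^ theta)%E.
  exact: (measurableT_comp (measurable_poweR _)).
have theta'_ge0 : 0 <= 1 - theta by rewrite subr_ge0.
have bound (M : R) : 0 < M -> (\int[P]_w Y w <= M%:E)%E ->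
    (\int[P]_w (Y w `^ theta) <= (M `^ theta)%:E)%E.
  move=> M_gt0 intY.
  have pointwise w : (Y w `^ theta <=
      (M `^ theta * (theta / M))%:E * Y w + (M `^ theta * (1 - theta))%:E)%E.
    have := Y_ge0 w; case: (Y w) => [y y_ge0|_|//]; last first.
      by rewrite gt0_muley ?leey// lte_fin !mulr_gt0 ?powR_gt0 ?invr_gt0.
    rewrite poweR_EFin -EFinM -EFinD lee_fin.
    rewrite lee_fin in y_ge0.
    have yM_ge0 : 0 <= y / M by rewrite divr_ge0// ltW.
    have theta_itv : 0 < theta <= 1 by rewrite theta_gt0.
    have tangent := powR_le_tangent yM_ge0 theta_itv.
    have -> : y `^ theta = M `^ theta * (y / M) `^ theta.
      by rewrite -powRM// ?(ltW M_gt0)// mulrCA divff ?gt_eqF// mulr1.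
    apply: (le_trans (ler_wpM2l (powR_ge0 M theta) tangent)).
    by rewrite le_eqVlt; apply/orP; left; apply/eqP; ring.
  apply: (@le_trans _ _ (\int[P]_w
      ((M `^ theta * (theta / M))%:E * Y w + (M `^ theta * (1 - theta))%:E))%E).
    apply: ge0_le_integral => //.
    - by move=> w _; exact: poweR_ge0.
    - by apply: emeasurable_funD => //; exact: measurable_funeM.
  rewrite ge0_integralD//; last 3 first.
  - move=> w _; rewrite mule_ge0// lee_fin !mulr_ge0 ?powR_ge0//
      ?invr_ge0 ltW//.
  - exact: measurable_funeM.
  - by move=> w _; rewrite lee_fin mulr_ge0// powR_ge0.
  rewrite ge0_integralZl//; last first.
    by rewrite lee_fin !mulr_ge0 ?powR_ge0// ?invr_ge0 ltW.
  rewrite integral_cst//= probability_setT mule1.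
  apply: (@le_trans _ _ ((M `^ theta * (theta / M))%:E * M%:E +
      (M `^ theta * (1 - theta))%:E)%E).
    apply: leeD2r; apply: lee_wpmul2l => //.
    by rewrite lee_fin !mulr_ge0 ?powR_ge0// ?invr_ge0 ltW.
  rewrite -EFinM -EFinD lee_fin -mulrA mulfVK ?gt_eqF// -mulrDr.
  by rewrite addrC subrK mulr1.
have intY_ge0 : (0 <= \int[P]_w Y w)%E by apply: integral_ge0.
case: (\int[P]_w Y w)%E intY_ge0 bound => [m m_ge0 bound|_ _|//]; last first.
  by rewrite poweRyr ?leey// gt_eqF.
rewrite lee_fin in m_ge0.
move: m_ge0; rewrite le_eqVlt => /predU1P[m0|m_gt0]; last first.
  by rewrite poweR_EFin; exact: bound.
rewrite -{}m0 in bound *.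
rewrite poweR_EFin powR0 ?gt_eqF//; apply/lee_addgt0Pr => e e_gt0.
(* At M = e^(1/theta) the bound M^theta equals e. *)
rewrite add0e -[e in leRHS]powRr1 ?(ltW e_gt0)//.
rewrite -(mulVf (lt0r_neq0 theta_gt0)) powRrM.
by apply: bound; rewrite ?lee_fin ?powR_ge0// powR_gt0.
Qed.

(** [integral_poweR_le] for |f|^r and the exponent p / r. *)
Lemma Lnorm_le d (T : measurableType d) (P : probability T R)
    (f : T -> \bar R) (p r : R) :
  measurable_fun setT f -> 1 <= p <= r ->
  ('N[P]_p%:E[f] <= 'N[P]_r%:E[f])%E.
Proof.
move=> mf /andP[p_ge1 p_le_r].
have p_gt0 : 0 < p by exact: lt_le_trans p_ge1.
have r_gt0 : 0 < r by exact: lt_le_trans p_le_r.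
rewrite unlock.
have -> : (r^-1 = (p / r) / p)%R by rewrite mulrAC divff ?gt_eqF// mul1r.
rewrite poweRrM; apply: gt0_ler_poweR; rewrite ?in_itv/= ?andbT ?leey ?andbT.
- by rewrite invr_ge0 ltW.
- by apply: integral_ge0 => w _; exact: poweR_ge0.
- exact: poweR_ge0.
have -> : (\int[P]_x (`|f x| `^ p) = \int[P]_x ((`|f x| `^ r) `^ (p / r)))%E.
  apply: eq_integral => w _.
  by rewrite -poweRrM mulrCA divff ?gt_eqF// mulr1.
apply: integral_poweR_le.
- apply: (measurableT_comp (measurable_poweR _)).
  exact: measurableT_comp.
- by move=> w; exact: poweR_ge0.
- by rewrite divr_gt0//= ler_pdivrMr// mul1r.
Qed.

End power_means.

(** * Expected powers of norms of a random function *)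

Section mixed_norms.
Context (R : realType) (d d' : measure_display).
Context (T : measurableType d) (S : measurableType d').
Context (P : probability T R) (sigma : probability S R).
Local Open Scope ereal_scope.

Lemma measurable_fun_Lnorm (f : T -> S -> R) (p : R) :
  measurable_fun setT (fun z : T * S => f z.1 z.2) ->
  measurable_fun setT (fun w => Lnorm sigma p%:E (fun u => (f w u)%:E)).
Proof.
move=> mf; rewrite unlock.
apply: (measurableT_comp (measurable_poweR _)).
apply: (@measurable_fun_fubini_tonelli_F _ _ _ _ _ sigma
  (fun z => `|(f z.1 z.2)%:E| `^ p)) => [|z]; last exact: poweR_ge0.
apply: (measurableT_comp (measurable_poweR _)).
by apply: measurableT_comp => //; exact/measurable_EFinP.
Qed.

(** Both exponents are raised to r = max(p, q): in the inner norm by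
    [Lnorm_le], in the outer mean by [integral_poweR_le] with exponent q / r.
    What remains is the double integral of |f|^r, where Tonelli's theorem lets
    the expectation be taken first, at a fixed u. *)
Lemma expectation_Lnorm_le (f : T -> S -> R) (p q M : R) (A : set S) :
  measurable_fun setT (fun z : T * S => f z.1 z.2) ->
  (1 <= p)%R -> (1 <= q)%R -> measurable A -> sigma A = 1 ->
  (forall u, A u -> \int[P]_w (`|f w u| `^ Num.max p q)%:E <= M%:E) ->
  \int[P]_w (Lnorm sigma p%:E (fun u => (f w u)%:E) `^ q)
    <= (M `^ (q / Num.max p q))%:E.
Proof.
move=> mf p_ge1 q_ge1 mA sigmaA; set r := Num.max p q => moment.
have p_le_r : (p <= r)%R by rewrite le_max lexx.
have q_le_r : (q <= r)%R by rewrite le_max lexx orbT.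
have q_gt0 : (0 < q)%R by exact: lt_le_trans q_ge1.
have r_gt0 : (0 < r)%R by exact: lt_le_trans q_le_r.
have mfr : measurable_fun setT (fun z : T * S => (`|f z.1 z.2| `^ r)%:E).
  apply/measurable_EFinP; apply: (measurableT_comp (measurable_powR _)).
  exact: measurableT_comp.
pose Y w := \int[sigma]_u (`|f w u| `^ r)%:E.
have M_ge0 : 0 <= M%:E.
  have [u Au] : A !=set0.
    apply/set0P/eqP => A0; move: sigmaA; rewrite A0 measure0 => /eqP.
    by rewrite lt_eqF// lte_fin.
  apply: le_trans (moment u Au).
  by apply: integral_ge0 => w _; rewrite lee_fin powR_ge0.
have Y_ge0 w : 0 <= Y w by apply: integral_ge0 => u _; rewrite lee_fin powR_ge0.
have mY : measurable_fun setT Y.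
  apply: (@measurable_fun_fubini_tonelli_F _ _ _ _ _ sigma
    (fun z => (`|f z.1 z.2| `^ r)%:E)) => //.
have mean_le : \int[P]_w (Lnorm sigma p%:E (fun u => (f w u)%:E) `^ q)
    <= \int[P]_w (Y w `^ (q / r)).
  apply: ge0_le_integral => //.
  - by move=> w _; exact: poweR_ge0.
  - apply: (measurableT_comp (measurable_poweR _)).
    exact: measurable_fun_Lnorm.
  - exact: (measurableT_comp (measurable_poweR _)).
  move=> w _; have mfw : measurable_fun setT (fun u => (f w u)%:E).
    apply/measurable_EFinP.
    exact: (measurableT_comp mf (pair1_measurable w)).
  have -> : Y w `^ (q / r) = Lnorm sigma r%:E (fun u => (f w u)%:E) `^ q.
    rewrite unlock -poweRrM mulrC; congr (_ `^ _).
  apply: gt0_ler_poweR; rewrite ?in_itv/= ?leey ?andbT ?Lnorm_ge0//.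
    exact: ltW.
  by apply: Lnorm_le; rewrite ?p_ge1.
apply: (le_trans mean_le); apply: (@le_trans _ _ ((\int[P]_w Y w) `^ (q / r))).
  apply: integral_poweR_le => //.
  by rewrite divr_gt0//= ler_pdivrMr// mul1r.
rewrite -poweR_EFin; apply: gt0_ler_poweR.
- by rewrite divr_ge0// ltW.
- by rewrite in_itv/= leey andbT integral_ge0.
- by rewrite in_itv/= leey andbT.
rewrite /Y (fubini_tonelli (fun z => (`|f z.1 z.2| `^ r)%:E))//.
apply: (@le_trans _ _ (\int[sigma]_u M%:E)); last first.
  by rewrite integral_cst//= probability_setT mule1.
apply: ae_ge0_le_integral => //.
- by move=> u _; apply: integral_ge0 => w _; rewrite lee_fin powR_ge0.
- exact: (@measurable_fun_fubini_tonelli_G _ _ _ _ _ P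
    (fun z => (`|f z.1 z.2| `^ r)%:E)).
exists (~` A); split.
- exact: measurableC.
- by rewrite /= probability_setC// sigmaA subee.
- by move=> u; apply: contra_not => Au _; exact: moment.
Qed.

End mixed_norms.

(** * Moments from a stretched exponential tail *)

Section moments_from_tails.
Context (R : realType).

(** A dyadic layer-cake bound: the last active indicator dominates x^r.  The
    cut-off at 2^N s keeps the sum finite, so that taking expectations needs
    no convergence argument. *)
Lemma powR_le_dyadic_sum (N : nat) (s r x : R) : 0 < s -> 0 <= r ->
  0 <= x <= 2 ^+ N * s ->
  x `^ r <= s `^ r + \sum_(k < N) (2 ^+ k.+1 * s) `^ r * (2 ^+ k * s < x)%R%:R.
Proof.
move=> s_gt0 r_ge0; elim: N => [|N IH] /andP[x_ge0 x_le].
  by rewrite big_ord0 addr0 ge0_ler_powR// ?nnegrE ?(ltW s_gt0)// -[s]mul1r.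
rewrite big_ord_recr/=; have [x_gt|x_le'] := ltP (2 ^+ N * s) x; last first.
  by rewrite mulr0 addr0 IH// x_ge0.
rewrite mulr1 addrA; apply: ler_wpDl.
  by rewrite addr_ge0 ?powR_ge0// sumr_ge0// => k _; rewrite mulr_ge0 ?powR_ge0.
by rewrite ge0_ler_powR// nnegrE// mulr_ge0 ?exprn_ge0// ltW.
Qed.

Lemma sum_half_powers_le (N : nat) : \sum_(k < N) (2 ^+ k)^-1 <= 2 :> R.
Proof.
have -> : \sum_(k < N) (2 ^+ k)^-1 = 2 - 2 / 2 ^+ N :> R.
  elim: N => [|N IH]; first by rewrite big_ord0 expr0 divr1 subrr.
  rewrite big_ord_recr/= IH exprS; field.
  by rewrite expf_neq0.
by rewrite gerBl divr_ge0// exprn_ge0.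
Qed.

Lemma expRN_le_inv (y : R) (m : nat) : 0 < y ->
  expR (- y) <= m.+1`!%:R / y ^+ m.+1.
Proof.
move=> y_gt0; rewrite expRN -[leRHS]invf_div.
rewrite lef_pV2 ?posrE ?expR_gt0 ?divr_gt0 ?exprn_gt0 ?ltr0n ?fact_gt0//.
by apply: le_trans (expR_ge1Dxn m (ltW y_gt0)); rewrite lerDr.
Qed.

(** Only the uniformity in N matters.  With m chosen so that
    alpha (m + 1) >= r + 1, the estimate exp (- y) <= (m + 1)! / y^(m + 1)
    makes the k-th term a constant multiple of 2^(-k). *)
Lemma dyadic_stretched_exponential_sum (alpha c r : R) :
  0 < alpha -> 0 < c -> 0 <= r ->
  exists2 C, 0 < C & forall N,
    1 + \sum_(k < N) (2 ^+ k.+1) `^ r * expR (- (c * (2 ^+ k) `^ alpha)) <= C.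
Proof.
move=> alpha_gt0 c_gt0 r_ge0.
have [m m_ge] : exists m : nat, r + 1 <= alpha * m.+1%:R.
  exists (Num.bound ((r + 1) / alpha)).
  rewrite -ler_pdivrMl// mulrC.
  have : 0 <= (r + 1) / alpha by rewrite divr_ge0 ?addr_ge0// ltW.
  by move=> /archi_boundP/ltW/le_trans; apply; rewrite ler_nat.
pose a := 2 `^ r * (m.+1`!%:R / c ^+ m.+1).
have a_gt0 : 0 < a.
  by rewrite mulr_gt0 ?powR_gt0// divr_gt0 ?exprn_gt0// ltr0n fact_gt0.
exists (1 + a * 2); first by rewrite addr_gt0// mulr_gt0.
move=> N; rewrite lerD2l.
apply: (@le_trans _ _ (\sum_(k < N) a * (2 ^+ k)^-1)); last first.
  by rewrite -mulr_sumr ler_pM2l// sum_half_powers_le.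
apply: ler_sum => k _.
have twok_ge1 : 1 <= 2 ^+ k :> R by rewrite exprn_ege1// ler1n.
have twok_gt0 : 0 < 2 ^+ k :> R by rewrite exprn_gt0.
have y_gt0 : 0 < c * (2 ^+ k) `^ alpha by rewrite mulr_gt0 ?powR_gt0.
apply: (le_trans (ler_wpM2l (powR_ge0 _ _) (expRN_le_inv m y_gt0))).
have -> : (2 ^+ k.+1) `^ r * (m.+1`!%:R / (c * (2 ^+ k) `^ alpha) ^+ m.+1)
    = a * ((2 ^+ k) `^ r / ((2 ^+ k) `^ alpha) ^+ m.+1).
  by rewrite exprS powRM ?(ltW twok_gt0)// exprMn invfM /a; ring.
rewrite ler_pM2l//.
move: (2 ^+ k) twok_ge1 twok_gt0 => t t_ge1 t_gt0.
rewrite -powR_mulrn ?powR_ge0// -powRrM.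
rewrite ler_pdivrMr ?powR_gt0// ler_pdivlMl//.
rewrite -[X in X * _ <= _]powRr1 ?(ltW t_gt0)// -powRD; last first.
  by rewrite (gt_eqF t_gt0) implybT.
by apply: ler_powR => //; rewrite addrC.
Qed.

(** The constant is independent of the scale s and of the bound B; B only
    serves to truncate the dyadic sum, and N may depend on it because
    [dyadic_stretched_exponential_sum] is uniform in N. *)
Lemma moment_le_of_tail (alpha c r : R) :
  0 < alpha -> 0 < c -> 0 <= r ->
  exists2 C, 0 < C & forall d (T : measurableType d) (P : probability T R)
    (Y : T -> R) (s B : R), measurable_fun setT Y -> 0 < s ->
    {ae P, forall w, 0 <= Y w <= B} ->
    (forall t, 0 < t ->
      (P [set w | (t < Y w)%R] <= (expR (- (c * (t / s) `^ alpha)))%:E)%E) ->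
    (\int[P]_w (`|Y w| `^ r)%:E <= (C * s `^ r)%:E)%E.
Proof.
move=> alpha_gt0 c_gt0 r_ge0.
have [C C_gt0 C_ge] := dyadic_stretched_exponential_sum alpha_gt0 c_gt0 r_ge0.
exists C => // d T P Y s B mY s_gt0 Y_bnd tail.
have [N N_ge] : exists N : nat, B <= 2 ^+ N * s.
  exists (Num.bound (B / s)); rewrite -ler_pdivrMr//.
  have [B_ge0|B_lt0] := leP 0 (B / s); last first.
    by rewrite (le_trans (ltW B_lt0))// exprn_ge0.
  apply/ltW/(lt_trans (archi_boundP B_ge0)).
  by rewrite -natrX ltr_nat ltn_expl.
pose A k := [set w | 2 ^+ k * s < Y w].
have mA k : measurable (A k).
  rewrite /A -[X in measurable X]setTI.
  exact: (measurable_fun_ltr (measurable_cst (2 ^+ k * s)) mY).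
pose a k := (2 ^+ k.+1 * s) `^ r.
apply: (@le_trans _ _ (\int[P]_w ((s `^ r)%:E +
    \sum_(k < N) (a k)%:E * (\1_(A k) w)%:E))%E).
  apply: ae_ge0_le_integral => //.
  - apply/measurable_EFinP; apply: (measurableT_comp (measurable_powR _)).
    exact: measurableT_comp.
  - move=> w _; rewrite adde_ge0// ?lee_fin ?powR_ge0// sume_ge0// => k _.
    by rewrite mule_ge0// lee_fin ?powR_ge0.
  - apply: emeasurable_funD => //; apply: emeasurable_sum => k.
    by apply: measurable_funeM; exact/measurable_EFinP.
  move: Y_bnd; apply: filterS => w Yw _.
  have /andP[Y_ge0 Y_le] := Yw.
  have Y_leN : 0 <= Y w <= 2 ^+ N * s by rewrite Y_ge0 (le_trans Y_le).
  have := powR_le_dyadic_sum s_gt0 r_ge0 Y_leN.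
  rewrite -lee_fin ger0_norm// => /le_trans; apply.
  rewrite EFinD -sumEFin; apply: leeD2l; apply: lee_sum => k _.
  rewrite -EFinM lee_fin indicE; apply: ler_wpM2l; first exact: powR_ge0.
  by rewrite /A; case: ltP => [Yk|_]; rewrite ?ler0n// mem_set.
rewrite ge0_integralD//; last 3 first.
- by move=> w _; rewrite lee_fin powR_ge0.
- move=> w _; rewrite sume_ge0// => k _.
  by rewrite mule_ge0// lee_fin ?powR_ge0.
- apply: emeasurable_sum => k.
  by apply: measurable_funeM; exact/measurable_EFinP.
rewrite integral_cst//= probability_setT mule1.
rewrite ge0_integral_sum//; last 2 first.
- by move=> k; apply: measurable_funeM; exact/measurable_EFinP.
- by move=> k w _; rewrite mule_ge0// lee_fin ?powR_ge0.
apply: (@le_trans _ _ ((s `^ r)%:E + \sum_(k < N)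
    (a k * expR (- (c * (2 ^+ k) `^ alpha)))%:E)%E).
  apply: leeD2l; apply: lee_sum => k _.
  rewrite ge0_integralZl//; last 2 first.
  - exact/measurable_EFinP.
  - by rewrite lee_fin powR_ge0.
  rewrite integral_indic// setIT EFinM; apply: lee_wpmul2l.
    by rewrite lee_fin powR_ge0.
  have := tail (2 ^+ k * s); rewrite mulfK ?gt_eqF//; apply.
  by rewrite mulr_gt0// exprn_gt0.
rewrite sumEFin -EFinD lee_fin.
apply: le_trans (ler_wpM2r (powR_ge0 s r) (C_ge N)).
rewrite mulrDl mul1r lerD2l mulr_suml; apply: ler_sum => k _.
rewrite /a powRM ?exprn_ge0// ?(ltW s_gt0)//.
by rewrite mulrAC.
Qed.

End moments_from_tails.

(** * Inner products, the ball and the sphere *)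

Section inner_product.
Context (R : realType) (d : nat).
Implicit Types u v x y : 'rV[R]_d.

Lemma dotpC u v : dotp u v = dotp v u.
Proof. by apply: eq_bigr => i _; rewrite mulrC. Qed.

Lemma dotpDr u x y : dotp u (x + y) = dotp u x + dotp u y.
Proof.
by rewrite /dotp -big_split; apply: eq_bigr => i _; rewrite mxE mulrDr.
Qed.

Lemma dotpZr u a x : dotp u (a *: x) = a * dotp u x.
Proof.
by rewrite /dotp mulr_sumr; apply: eq_bigr => i _; rewrite mxE mulrCA.
Qed.

Lemma dotpNl u v : dotp (- u) v = - dotp u v.
Proof. by rewrite /dotp -sumrN; apply: eq_bigr => i _; rewrite mxE mulNr. Qed.

Lemma dotpNr u v : dotp u (- v) = - dotp u v.
Proof. by rewrite dotpC dotpNl dotpC. Qed.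

Lemma dotp_ge0 u : 0 <= dotp u u.
Proof. by apply: sumr_ge0 => i _; rewrite -expr2 sqr_ge0. Qed.

(** The arithmetic mean stands in for the product of the norms, so that no
    square root occurs; on unit vectors both bounds equal 1. *)
Lemma dotp_le_mean u v : dotp u v <= (dotp u u + dotp v v) / 2.
Proof.
rewrite /dotp -big_split/= mulr_suml; apply: ler_sum => i _.
have := sqr_ge0 (u ord0 i - v ord0 i); nra.
Qed.

Lemma normr_dotp_le u v : `|dotp u v| <= (dotp u u + dotp v v) / 2.
Proof.
rewrite ler_norml dotp_le_mean andbT lerNl -dotpNl.
by have := dotp_le_mean (- u) v; rewrite [dotp (- u) (- u)]dotpNl dotpNr opprK.
Qed.

Lemma usphere_dotp u : usphere u -> dotp u u = 1.
Proof.
by rewrite /usphere/= /enorm => u1; rewrite -(sqr_sqrtr (dotp_ge0 u)) u1 expr1n.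
Qed.

Lemma usphereN u : usphere u -> usphere (- u).
Proof. by rewrite /usphere/= /enorm dotpNl dotpNr opprK. Qed.

Lemma eball01_dotp x : eball 0 1 x -> dotp x x <= 1.
Proof.
rewrite /eball/= subr0 /enorm => x1.
by rewrite -(sqr_sqrtr (dotp_ge0 x)) expr_le1.
Qed.

Lemma continuous_dotp x : continuous (fun u => dotp u x).
Proof.
apply: continuous_big => [|i _ u]; first exact: add_continuous.
apply: continuousM; last exact: cst_continuous.
exact: (@coord_continuous R 1 d ord0 i u).
Qed.

End inner_product.

(** * Borel sets and null sets of R^d *)

Section borel_structure.
Context (R : realType) (d : nat).

Lemma open_measurable_rV (A : set 'rV[R]_d) :
  open A -> measurable (A : set (rVborel R d)).
Proof. exact: sub_sigma_algebra. Qed.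

Lemma closed_measurable_rV (A : set 'rV[R]_d) :
  closed A -> measurable (A : set (rVborel R d)).
Proof.
move=> cA; rewrite -(setCK A); apply: measurableC; apply: open_measurable_rV.
exact: closed_openC.
Qed.

Lemma lower_semicontinuous_measurable_rV (f : 'rV[R]_d -> R) :
  (forall a, open [set u | a < f u]) ->
  measurable_fun setT (f : rVborel R d -> R).
Proof.
move=> f_lsc mD; apply: (measurability _ (RGenOInfty.measurableE R)) => //.
move=> _ [_ [a ->] <-]; rewrite setTI; apply: open_measurable_rV.
rewrite (_ : _ @^-1` _ = [set u | a < f u])//.
by apply/seteqP; split => u /=; rewrite in_itv/= andbT.
Qed.

Lemma continuous_measurable_rV (f : 'rV[R]_d -> R) :
  continuous f -> measurable_fun setT (f : rVborel R d -> R).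
Proof.
move=> cf; apply: lower_semicontinuous_measurable_rV => a.
by move/continuousP: cf => /(_ _ (@open_gt _ a)).
Qed.

Lemma measurable_dotp d' (T : measurableType d') (g h : T -> rVborel R d) :
  measurable_fun setT g -> measurable_fun setT h ->
  measurable_fun setT (fun t => dotp (g t) (h t)).
Proof.
move=> mg mh; apply: measurable_sum => i.
have mcoord :
    measurable_fun setT (fun x : rVborel R d => (x : 'rV[R]_d) ord0 i).
  by apply: continuous_measurable_rV; exact: coord_continuous.
by apply: measurable_funM; exact: (measurableT_comp mcoord).
Qed.

Lemma measurable_usphere : measurable (@usphere R d : set (rVborel R d)).
Proof.
have mdot : measurable_fun setT (fun u : rVborel R d => dotp u u).
  exact: measurable_dotp.
rewrite (_ : usphere (d:=d) = (fun u => dotp u u) @^-1` [set 1]).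
  by rewrite -[X in measurable X]setTI; exact: mdot.
apply/seteqP; split => u /=; first exact: usphere_dotp.
by rewrite /usphere/= /enorm => ->; rewrite sqrtr1.
Qed.

(** A point outside the support has a null open neighbourhood, which contains a
    null box around that point with rational centre and radius 1 / (k + 1);
    there are countably many such boxes. *)
Lemma negligible_setC_msupport (mu : {measure set (rVborel R d) -> \bar R}) :
  mu.-negligible (~` msupport mu).
Proof.
pose box (c : 'rV[rat]_d * nat) : set 'rV[R]_d :=
  ball (map_mx ratr c.1 : 'rV[R]_d) (c.2.+1%:R^-1).
have box_open c : open (box c) by apply: ball_open; rewrite invr_gt0.
(* The null boxes, enumerated by [pickle]; all other indices give set0. *)
pose F n : set (rVborel R d) := if unpickle n is Some c then
  (if mu (box c) == 0%E then box c else set0) else set0.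
have F_null n : mu.-negligible (F n).
  rewrite /F; case: unpickle => [c|]; last exact: negligible_set0.
  case: eqP => [box0|_]; last exact: negligible_set0.
  by apply/negligibleP => //; exact: open_measurable_rV.
apply: negligibleS (negligible_bigcup F_null) => x /=.
rewrite /msupport/= -existsNP => -[U] /not_implyP[U_open] /not_implyP[Ux].
move=> /negP; rewrite -leNgt measure_le0 => /eqP U0.
have [e e_gt0 ball_U] : exists2 e : R, 0 < e & ball x e `<=` U.
  by apply/nbhs_ballP; exact: open_nbhs_nbhs.
pose k := Num.bound (2 / e).
have k_lt : k.+1%:R^-1 < e / 2.
  rewrite -[X in _ < X]invf_div ltf_pV2 ?posrE ?divr_gt0//.
  apply: lt_trans (archi_boundP _) _; first by rewrite ltW// divr_gt0.
  by rewrite ltr_nat.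
have k_gt0 : 0 < k.+1%:R^-1 :> R by rewrite invr_gt0.
have approx i : exists q : rat, ball (x ord0 i) k.+1%:R^-1 (ratr q : R).
  have [] := @dense_rat R (ball (x ord0 i) k.+1%:R^-1).
  - by exists (x ord0 i); exact: ballxx.
  - exact: ball_open.
  by move=> y [xy [q _ qE]]; exists q; rewrite qE.
have [q qP] := choice approx.
pose c : 'rV[rat]_d * nat := (\row_i q i, k).
have box_x : box c x.
  by split=> // i j; rewrite !mxE ord1; exact: ball_sym.
have box_U : box c `<=` U.
  apply: subset_trans ball_U => y box_y.
  rewrite (splitr e); apply: ball_triangle; last first.
    exact: le_ball (ltW k_lt) _ box_y.
  exact: le_ball (ltW k_lt) _ (ball_sym box_x).
exists (pickle c) => //; rewrite /F pickleK.
case: eqP => // -[].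
apply/eqP; rewrite -measure_le0 -U0; apply: le_measure => //; rewrite inE;
  exact: open_measurable_rV.
Qed.

End borel_structure.

(** * Support functions *)

Section support_functions.
Context (R : realType) (d : nat).
Implicit Types (K : set 'rV[R]_d) (u x : 'rV[R]_d).

Lemma dotp_le_supp_fun K u x : K `<=` eball 0 1 -> K x ->
  dotp u x <= supp_fun K u.
Proof.
move=> K1 Kx; apply: ub_le_sup; last by exists x.
exists ((dotp u u + 1) / 2) => _ [y Ky <-].
apply: le_trans (dotp_le_mean u y) _.
by rewrite ler_pM2r ?invr_gt0// lerD2l eball01_dotp//; exact: K1.
Qed.

(** A supremum of continuous functions is lower semicontinuous. *)
Lemma measurable_supp_fun K : K !=set0 -> K `<=` eball 0 1 ->
  measurable_fun setT (supp_fun K : rVborel R d -> R).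
Proof.
move=> K0 K1; apply: lower_semicontinuous_measurable_rV => a.
rewrite (_ : [set u | _] = \bigcup_(x in K) [set u | a < dotp u x]).
  apply: bigcup_open => x _.
  have /continuousP := @continuous_dotp R d x.
  by move=> /(_ _ (@open_gt _ a)).
apply/seteqP; split=> u /=.
  have dotp0 : [set dotp u x | x in K] !=set0.
    by case: K0 => x Kx; exists (dotp u x); exists x.
  by move=> /(sup_gt dotp0)[_ [x Kx <-] ax]; exists x.
by move=> [x Kx /= /lt_le_trans]; apply; exact: dotp_le_supp_fun.
Qed.

Lemma convex_half_space u b :
  convex_set ([set x | dotp u x <= b] : set (convex_lmodType 'rV[R]_d)).
Proof.
move=> x y t; rewrite !inE/= => xb yb.
rewrite dotpDr !dotpZr.
apply: (@le_trans _ _ (t%:inum * b + (1 - t%:inum) * b)).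
  by apply: lerD; apply: ler_wpM2l => //; rewrite subr_ge0.
by rewrite -mulrDl addrC subrK mul1r.
Qed.

(** Half-spaces are convex, so an inner product bounded on the points is
    bounded by the same number on their hull.  The maximum is started at the
    value at [i0], which makes it independent of any default value. *)
Lemma supp_fun_conv_hull n (x : 'I_n -> 'rV[R]_d) (i0 : 'I_n) u :
  supp_fun (conv_hull (range x)) u
    = \big[Num.max/dotp u (x i0)]_(i < n) dotp u (x i).
Proof.
set m := \big[_/_]_(_ < _) _.
have hull_le : conv_hull (range x) `<=` [set y | dotp u y <= m].
  apply: smallest_sub; first exact: convex_half_space.
  by move=> _ [i _ <-]; exact: le_bigmax.
have hull_x i : conv_hull (range x) (x i) by apply: sub_gen_smallest; exists i.
apply/eqP; rewrite eq_le; apply/andP; split.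
  apply: ge_sup; first by exists (dotp u (x i0)); exists (x i0).
  by move=> _ [y /hull_le ? <-].
have le_sup i : dotp u (x i) <= supp_fun (conv_hull (range x)) u.
  apply: ub_le_sup; last by exists (x i).
  by exists m => _ [y /hull_le ? <-].
by apply: bigmax_le.
Qed.

Lemma measurable_supp_fun_hat_K d' (T : measurableType d') (P : probability T R)
    (n : nat) (X : 'I_n -> {RV P >-> rVborel R d}) : (0 < n)%N ->
  measurable_fun setT (fun z : T * rVborel R d => supp_fun (hat_K X z.1) z.2).
Proof.
move=> n_gt0; pose i0 := Ordinal n_gt0.
under eq_fun do rewrite /hat_K (supp_fun_conv_hull _ i0).
have mX i : measurable_fun setT (fun z : T * rVborel R d => dotp z.2 (X i z.1)).
  apply: measurable_dotp; first exact: measurable_snd.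
  by apply: measurableT_comp => //; exact: measurable_fst.
elim: (index_enum _) => [|i s IH].
  by under eq_fun do rewrite big_nil; exact: mX.
under eq_fun do rewrite big_cons.
exact: measurable_maxr.
Qed.

End support_functions.

(** * The hull of an i.i.d. sample *)

Section random_hull.
Context (R : realType) (d : nat).
Context (dT : measure_display) (T : measurableType dT) (P : probability T R).
Context (mu : probability (rVborel R d) R).
Context (n : nat) (X : 'I_n -> {RV P >-> rVborel R d}).
Hypothesis X_iid : iid mu X.

Lemma all_missE (A : set (rVborel R d)) :
  [set w | forall i, ~ A (X i w)] =
    \bigcap_(i in [set` [set: 'I_n]%SET]) (X i @^-1` (~` A)).
Proof.
apply/seteqP; split => w /= Xw i; first by move=> _; exact: Xw.
by apply: Xw; rewrite /= inE.
Qed.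

Lemma measurable_all_miss (A : set (rVborel R d)) : measurable A ->
  measurable [set w | forall i, ~ A (X i w)].
Proof.
move=> mA; rewrite all_missE; apply: fin_bigcap_measurable => // i _.
rewrite -[X in measurable X]setTI; apply: measurable_funP => //.
exact: measurableC.
Qed.

(** The probability is (1 - mu A)^n, and 1 - a <= exp (- a). *)
Lemma iid_all_miss_le (A : set (rVborel R d)) (a : R) : measurable A ->
  (a%:E <= mu A)%E ->
  (P [set w | forall i, ~ A (X i w)] <= (expR (- (n%:R * a)))%:E)%E.
Proof.
move=> mA A_ge; have [indep same] := X_iid.
have mAC : measurable (~` A) by exact: measurableC.
rewrite all_missE (indep _ (fun _ => ~` A))//.
have missE i : P (X i @^-1` (~` A)) = (1 - fine (mu A))%:E.
  rewrite -[LHS]/(distribution P (X i) (~` A)) same// probability_setC//.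
  by rewrite EFinB fineK// fin_num_measure.
rewrite (eq_bigr (fun=> (1 - fine (mu A))%:E)); last first.
  by move=> i _; exact: missE.
rewrite prodEFin lee_fin prodr_const cardsT card_ord -mulrN expRM_natl.
have a_le : a <= fine (mu A) by rewrite -lee_fin fineK// fin_num_measure.
apply: lerXn2r; rewrite ?nnegrE ?expR_ge0//.
  by rewrite subr_ge0 -lee_fin fineK ?fin_num_measure// probability_le1.
apply: le_trans (expR_ge1Dx (- a)).
by rewrite lerD2l lerN2.
Qed.

Lemma iid_ae_mem (K : set 'rV[R]_d) : closed K -> msupport mu `<=` K ->
  {ae P, forall w, forall i, K (X i w)}.
Proof.
move=> K_closed supp_K; have [_ same] := X_iid.
have mK : measurable (K : set (rVborel R d)) by exact: closed_measurable_rV.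
have muKC : mu (~` K) = 0%E.
  apply: measure_negligible; first exact: measurableC.
  apply: negligibleS (negligible_setC_msupport mu).
  exact: subsetC.
have one i : {ae P, forall w, K (X i w)}.
  exists (X i @^-1` (~` K)); split => //.
  - rewrite -[X in measurable X]setTI; apply: measurable_funP => //.
    exact: measurableC.
  - by rewrite -[LHS]/(distribution P (X i) (~` K)) same//; exact: measurableC.
(* Ordinals are embedded into nat to use the countable intersection. *)
have : {ae P, forall w, forall k,
    if insub k is Some i then K (X i w) else True}.
  by apply: ae_foralln => k; case: insub => [i|]; [exact: one | exact: aeW].
by apply: filterS => w Kw i; have := Kw i; rewrite valK.
Qed.

Lemma ae_deficit_itv (K : set 'rV[R]_d) u : (0 < n)%N ->
  closed K -> msupport mu `<=` K -> K `<=` eball 0 1 -> K !=set0 -> usphere u ->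
  {ae P, forall w, 0 <= supp_fun K u - supp_fun (hat_K X w) u <= 2}.
Proof.
move=> n_gt0 K_closed supp_K K1 [x0 Kx0] u1; pose i0 := Ordinal n_gt0.
have bnd x : K x -> -1 <= dotp u x <= 1.
  move=> Kx; rewrite -ler_norml; apply: le_trans (normr_dotp_le u x) _.
  rewrite (usphere_dotp u1) ler_pdivrMr// mul1r -natr1 addrC lerD2r.
  exact/eball01_dotp/K1.
have supp_le1 : supp_fun K u <= 1.
  apply: ge_sup; first by exists (dotp u x0); exists x0.
  by move=> _ [x /bnd /andP[_ ?] <-].
have := iid_ae_mem K_closed supp_K; apply: filterS => w KX.
rewrite /hat_K (supp_fun_conv_hull _ i0) subr_ge0; apply/andP; split.
  by apply: bigmax_le => [|i _]; exact: dotp_le_supp_fun.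
rewrite lerBlDr (le_trans supp_le1)//.
have /andP[ge_m1 _] := bnd _ (KX i0).
have := le_bigmax (dotp u (X i0 w)) (fun i => dotp u (X i w)) i0.
by move: ge_m1 => /=; lra.
Qed.

End random_hull.

(** * Moments of the deficit in a fixed direction *)

Section deficit_moments.
Context (R : realType).

Lemma measurable_cap d (K : set 'rV[R]_d) u eps : closed K ->
  measurable (cap K u eps : set (rVborel R d)).
Proof.
move=> K_closed; apply: measurableI; first exact: closed_measurable_rV.
rewrite -[X in measurable X]setTI.
have mdot : measurable_fun setT (fun x : rVborel R d => dotp u x).
  by apply: measurable_dotp.
exact: (measurable_fun_ler (measurable_cst (supp_fun K u - eps)) mdot).
Qed.

Lemma measurable_deficit d (K : set 'rV[R]_d) dT (T : measurableType dT)
    (P : probability T R) n (X : 'I_n -> {RV P >-> rVborel R d}) : (0 < n)%N ->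
  K `<=` eball 0 1 -> K !=set0 ->
  measurable_fun setT (fun z : T * rVborel R d =>
    supp_fun K z.2 - supp_fun (hat_K X z.1) z.2).
Proof.
move=> n_gt0 K1 K0.
apply: measurable_funB; last exact: measurable_supp_fun_hat_K.
apply: (measurableT_comp (measurable_supp_fun K0 K1)).
exact: measurable_snd.
Qed.

(** A deficit larger than t forces all sample points to miss the cap of depth
    t, a fortiori the cap of depth t eps0 / 2.  For t <= 2 this depth is at
    most eps0, so the cap hypothesis applies at every scale with the single
    constant L (eps0 / 2)^alpha; for t > 2 the event is null. *)
Lemma deficit_moment_le (alpha L eps0 r : R) :
  0 < alpha -> 0 < L -> 0 < eps0 -> eps0 <= 1 -> 0 <= r ->
  exists2 C : R, 0 < C &
  forall d (K : set 'rV[R]_d) (mu : probability (rVborel R d) R),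
  closed K -> K !=set0 -> K `<=` eball 0 1 -> msupport mu `<=` K ->
  (forall u, usphere u -> forall eps : R, 0 <= eps <= eps0 ->
     ((L * eps `^ alpha)%:E <= mu (cap K u eps))%E) ->
  forall n : nat, (0 < n)%N ->
  forall dT (T : measurableType dT) (P : probability T R)
         (X : 'I_n -> {RV P >-> rVborel R d}),
  iid mu X -> forall u, usphere u ->
  (\int[P]_w (`|supp_fun K u - supp_fun (hat_K X w) u| `^ r)%:E
     <= (C * (n%:R `^ (- alpha^-1)) `^ r)%:E)%E.
Proof.
move=> alpha_gt0 L_gt0 eps0_gt0 eps0_le1 r_ge0.
pose c := L * (eps0 / 2) `^ alpha.
have e_gt0 : 0 < eps0 / 2 by rewrite divr_gt0.
have c_gt0 : 0 < c by rewrite mulr_gt0// powR_gt0.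
have [C C_gt0 moment] := moment_le_of_tail alpha_gt0 c_gt0 r_ge0.
exists C => // d K mu K_closed K0 K1 supp_K caps n n_gt0 dT T P X X_iid u u1.
have mD : measurable_fun setT (fun w => supp_fun K u - supp_fun (hat_K X w) u).
  have md := measurable_deficit X n_gt0 K1 K0.
  pose pair (w : T) : T * rVborel R d := (w, u).
  have mpair : measurable_fun setT pair by exact: pair2_measurable.
  exact: (measurableT_comp md mpair).
have D_bnd := ae_deficit_itv X_iid n_gt0 K_closed supp_K K1 K0 u1.
apply: (moment _ _ _ _ _ _ mD _ D_bnd); first by apply: powR_gt0; rewrite ltr0n.
move=> t t_gt0.
have mDt : measurable [set w | t < supp_fun K u - supp_fun (hat_K X w) u].
  rewrite -[X in measurable X]setTI.
  exact: (measurable_fun_ltr (measurable_cst t) mD).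
have [t_le2|t_gt2] := leP t 2; last first.
  rewrite [leLHS](_ : _ = 0%E) ?lee_fin ?expR_ge0//.
  apply: measure_negligible => //; apply: negligibleS D_bnd => w /=.
  move=> tD /andP[_ D_le2].
  by move: (lt_le_trans tD D_le2); rewrite ltNge (ltW t_gt2).
pose eps := t * (eps0 / 2).
have eps_gt0 : 0 < eps by rewrite mulr_gt0.
have eps_le : eps <= eps0.
  by rewrite /eps mulrCA ger_pMr// ler_pdivrMr// mul1r.
have eps_le_t : eps <= t.
  rewrite /eps ger_pMr// ler_pdivrMr// mul1r; lra.
have cap_ge : ((L * eps `^ alpha)%:E <= mu (cap K u eps))%E.
  by apply: caps => //; rewrite (ltW eps_gt0).
(* The scale n^(-1/alpha) absorbs the factor n of the exponent. *)
have -> : c * (t / n%:R `^ (- alpha^-1)) `^ alpha = n%:R * (L * eps `^ alpha).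
  rewrite powRN invrK powRM ?powR_ge0// ?(ltW t_gt0)//.
  rewrite -powRrM mulVf ?gt_eqF// powRr1//.
  by rewrite /eps powRM ?(ltW t_gt0)// ?(ltW e_gt0)// /c; ring.
have miss := iid_all_miss_le X_iid (measurable_cap u eps K_closed) cap_ge.
apply: (le_trans _ miss).
apply: le_measure; rewrite ?inE//.
  exact: measurable_all_miss (measurable_cap u eps K_closed).
move=> w /= tD i [_ /=]; apply/negP; rewrite -ltNge.
have le_hat : dotp u (X i w) <= supp_fun (hat_K X w) u.
  rewrite /hat_K (supp_fun_conv_hull _ i); exact: le_bigmax.
by move: tD eps_le_t le_hat; lra.
Qed.

End deficit_moments.

(** * Width and the rate of convergence *)

Section width_deficit.
Context (R : realType).

Lemma powR_normD_le (r a b : R) : 0 <= r ->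
  `|a + b| `^ r <= 2 `^ r * (`|a| `^ r + `|b| `^ r).
Proof.
move=> r_ge0; wlog le_ab : a b / `|a| <= `|b| => [wlog_ab|].
  have [|/ltW] := leP `|a| `|b|; first exact: wlog_ab.
  by rewrite [a + b]addrC [X in _ * X]addrC; exact: wlog_ab.
apply: (@le_trans _ _ ((2 * `|b|) `^ r)).
  rewrite ge0_ler_powR ?nnegrE ?mulr_ge0//.
  by rewrite (le_trans (ler_normD a b))// mulr2n mulrDl mul1r lerD2r.
by rewrite powRM// ler_wpM2l ?powR_ge0// lerDr powR_ge0.
Qed.

Lemma measurable_opp_rV d :
  measurable_fun setT (-%R : rVborel R d -> rVborel R d).
Proof.
move=> mT; apply: (@measurability _ _ _ _ setT
  (-%R : rVborel R d -> rVborel R d) (@open 'rV[R]_d)) => //.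
move=> _ [U U_open <-]; rewrite setTI; apply: sub_sigma_algebra.
have /continuousP opp_cont : continuous (-%R : 'rV[R]_d -> 'rV[R]_d).
  exact: opp_continuous.
exact: opp_cont.
Qed.

End width_deficit.

Theorem theorem2 (R : realType) (d : nat) (alpha L eps0 p q : R)
  (d_gt0 : (0 < d)%N) (alpha_gt0 : 0 < alpha) (L_gt0 : 0 < L)
  (eps0_gt0 : 0 < eps0) (eps0_le1 : eps0 <= 1)
  (p_ge1 : 1 <= p) (q_ge1 : 1 <= q) :
  exists2 c : R, 0 < c &
  forall (sigma : probability (rVborel R d) R) (K : set 'rV[R]_d)
         (mu : probability (rVborel R d) R),
  sphere_uniform sigma ->
  convex_body K ->
  K `<=` eball 0 1 ->
  msupport mu `<=` K ->
  (forall u, usphere u -> forall eps : R, 0 <= eps <= eps0 ->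
     ((L * eps `^ alpha)%:E <= mu (cap K u eps))%E) ->
  forall n : nat, (1 <= n)%N ->
  forall (dT : measure_display) (T : measurableType dT) (P : probability T R)
         (X : 'I_n -> {RV P >-> rVborel R d}),
  iid mu X ->
  (E_Lnorm_pow P sigma p q
     (fun w u => (supp_fun K u - supp_fun (hat_K X w) u)%R)
   <= (c * n%:R `^ (- (q / alpha)))%:E)%E /\
  (E_Lnorm_pow P sigma p q
     (fun w u => (width_fun K u - width_fun (hat_K X w) u)%R)
   <= (c * n%:R `^ (- (q / alpha)))%:E)%E.
Proof.
set r := Num.max p q.
have r_ge1 : 1 <= r by rewrite le_max p_ge1.
have r_gt0 : 0 < r by exact: lt_le_trans r_ge1.
have r_ge0 := ltW r_gt0.
have [C C_gt0 moment] :=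
  deficit_moment_le alpha_gt0 L_gt0 eps0_gt0 eps0_le1 r_ge0.
(* The constant for the width, which exceeds the one for the deficit. *)
pose C' := 2 `^ r * (C + C).
have C'_gt0 : 0 < C' by rewrite mulr_gt0 ?powR_gt0 ?addr_gt0.
exists (C' `^ (q / r)); first by rewrite powR_gt0.
move=> sigma K mu [sigma1 _] [K_compact _ K_int] K1 supp_K caps.
move=> n n_ge1 dT T P X X_iid.
have K_closed : closed K by apply: compact_closed => //; exact: norm_hausdorff.
have K0 : K !=set0 by case: K_int => x /interior_subset Kx; exists x.
have {}moment := moment _ _ _ K_closed K0 K1 supp_K caps _ n_ge1 _ _ _ _ X_iid.
set s := n%:R `^ (- alpha^-1) in moment.
have s_ge0 : 0 <= s by exact: powR_ge0.
have rate (D : T -> 'rV[R]_d -> R) :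
    measurable_fun setT (fun z : T * rVborel R d => D z.1 z.2) ->
    (forall u, usphere u ->
      (\int[P]_w (`|D w u| `^ r)%:E <= (C' * s `^ r)%:E)%E) ->
    (E_Lnorm_pow P sigma p q D <=
      (C' `^ (q / r) * n%:R `^ (- (q / alpha)))%:E)%E.
  move=> mD D_le.
  have -> : C' `^ (q / r) * n%:R `^ (- (q / alpha)) = (C' * s `^ r) `^ (q / r).
    rewrite powRM ?powR_ge0 ?(ltW C'_gt0)//; congr (_ * _).
    rewrite /s -!powRrM; congr (_ `^ _).
    by field; rewrite !gt_eqF.
  exact: (expectation_Lnorm_le mD p_ge1 q_ge1 (@measurable_usphere R d)
    sigma1 D_le).
pose D w u := supp_fun K u - supp_fun (hat_K X w) u.
have mD : measurable_fun setT (fun z : T * rVborel R d => D z.1 z.2).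
  exact: measurable_deficit.
have C_le : C <= C'.
  rewrite /C' mulrDr; apply: ler_wpDr.
    by rewrite mulr_ge0 ?powR_ge0// ltW.
  by rewrite ler_peMl ?(ltW C_gt0)// -[leLHS](powRr0 2) ler_powR// ler1n.
have widthE w u :
    width_fun K u - width_fun (hat_K X w) u = D w u + D w (- u).
  by rewrite /width_fun /D opprD addrACA.
pose opp2 (z : T * rVborel R d) : T * rVborel R d := (z.1, - (z.2 : 'rV[R]_d)).
have mopp2 : measurable_fun setT opp2.
  apply/measurable_fun_pairP; split; first exact: measurable_fst.
  apply: (measurableT_comp (@measurable_opp_rV R d)); exact: measurable_snd.
have mDopp : measurable_fun setT (fun z : T * rVborel R d => D z.1 (- z.2)).
  exact: (measurableT_comp mD mopp2).
split; apply: rate => //.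
- move=> u u1; apply: (le_trans (moment u u1)).
  by rewrite lee_fin ler_wpM2r// powR_ge0.
- under eq_fun do rewrite widthE; exact: measurable_funD.
move=> u u1; have mDr v : measurable_fun setT (fun w => (`|D w v| `^ r)%:E).
  apply/measurable_EFinP; apply: (measurableT_comp (measurable_powR _)).
  apply: measurableT_comp => //.
  exact: (measurableT_comp mD (pair2_measurable (v : rVborel R d))).
under eq_integral do rewrite widthE.
apply: (@le_trans _ _ (\int[P]_w ((2 `^ r)%:E *
    ((`|D w u| `^ r)%:E + (`|D w (- u)| `^ r)%:E)))%E).
  apply: ge0_le_integral => //.
  - apply/measurable_EFinP; apply: (measurableT_comp (measurable_powR _)).
    apply: measurableT_comp => //; apply: measurable_funD.
      exact: (measurableT_comp mD (pair2_measurable (u : rVborel R d))).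
    exact: (measurableT_comp mD (pair2_measurable (- u : rVborel R d))).
  - by apply: measurable_funeM; exact: emeasurable_funD.
  by move=> w _; rewrite -EFinD -EFinM lee_fin powR_normD_le.
rewrite ge0_integralZl//; last 2 first.
- exact: emeasurable_funD.
- by move=> w _; rewrite adde_ge0// lee_fin powR_ge0.
rewrite ge0_integralD// /C' -mulrA EFinM mulrDl EFinD.
apply: lee_wpmul2l; first by rewrite lee_fin powR_ge0.
by apply: leeD; apply: moment => //; exact: usphereN.
Qed.
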